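(* Let $\mathcal{X}$ be an $n$-order tensor and let $\sigma,\tau\in S_n$. Then $$(\mathcal{X}^{T\sigma})^{T\tau}=\mathcal{X}^{T(\tau\sigma)},$$ where $\tau\sigma$ denotes the composition of the two permutations, $(\tau\sigma)(i)=\tau(\sigma(i))$.
   Context: $S_n$ is the group of all permutations of $\{1,\dots,n\}$. An $n$-order (real) tensor of size $I_1\times\cdots\times I_n$ is an array with entries $\mathcal{X}(i_1,\dots,i_n)$, $1\le i_k\le I_k$. Tensor transpose: for a non-identity permutation $\sigma\in S_n$, the transpose of $\mathcal{X}$ associated with $\sigma$, denoted $\mathcal{X}^{T\sigma}$, is the tensor of size $I_{\sigma(1)}\times\cdots\times I_{\sigma(n)}$ with entries $\mathcal{X}^{T\sigma}(i_{\sigma(1)},i_{\sigma(2)},\dots,i_{\sigma(n)})=\mathcal{X}(i_1,i_2,\dots,i_n)$. When the permutation is the identity, the transpose is understood to be $\mathcal{X}$ itself.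
   Formalization: The composition is taken in the opposite order, $(\tau\sigma)(i)=\sigma(\tau(i))$ instead of $\tau(\sigma(i))$, because with the given definition of the transpose the stated order fails (e.g. sizes 1×2×3, $\sigma=(1\,2)$, $\tau=(2\,3)$). *)

(* Defs.v *)
From mathcomp Require Import all_boot all_order all_algebra all_fingroup.
From mathcomp Require Import boolp reals.

Set Implicit Arguments.
Unset Strict Implicit.
Unset Printing Implicit Defensive.

(* Modes are numbered from 0, and so are the positions within a mode.  The
   sizes are a field of the tensor, not a parameter of its type, so that the
   equality of two tensors asserts both that their sizes agree and that their
   entries do. *)
Record tensor (R : realType) (n : nat) := Tensor {
  dims : 'I_n -> nat;
  entry :> (forall k : 'I_n, 'I_(dims k)) -> R
}.

(* The transpose Y has sizes I_(s 0), I_(s 1), ... and satisfies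
     Y (i_(s 0), i_(s 1), ...) = X (i_0, i_1, ...),
   see transposeE.  Solved for Y, this reads Y j = X i with i_k = j_(s^-1 k);
   the cast identifies 'I_(dims X (s (s^-1 k))) with 'I_(dims X k). *)
Definition transpose (R : realType) (n : nat) (X : tensor R n) (s : 'S_n) :
    tensor R n :=
  @Tensor R n (fun k => dims X (s k))
    (fun j => X (fun k => cast_ord (congr1 (dims X) (permKV s k))
                                   (j ((s^-1)%g k)))).

Lemma transposeE (R : realType) (n : nat) (X : tensor R n) (s : 'S_n)
    (i : forall k, 'I_(dims X k)) :
  transpose X s (fun k => i (s k)) = X i.
Proof.
rewrite /=; congr (entry _); apply: functional_extensionality_dep => k.
by apply: val_inj; rewrite /= permKV.
Qed.

Lemma tensor_eqP (R : realType) (n : nat) (X Y : tensor R n) :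
    (forall k, dims X k = dims Y k) ->
    (forall (i : forall k, 'I_(dims X k)) (j : forall k, 'I_(dims Y k)),
      (forall k, i k = j k :> nat) -> X i = Y j) ->
  X = Y.
Proof.
case: X Y => [I x] [J y] /= /funext IJ; case: J / IJ y => y xy.
by congr Tensor; apply: funext => i; apply: xy.
Qed.

Lemma transpose1 (R : realType) (n : nat) (X : tensor R n) :
  transpose X 1%g = X.
Proof.
apply: tensor_eqP => [k|i j ij] /=; first by rewrite perm1.
congr (entry _); apply: functional_extensionality_dep => k.
by apply: val_inj; rewrite /= ij invg1 perm1.
Qed.

(* The product of 'S_n composes from left to right: permM states that
   (t * s)%g k = s (t k).  This is the order in which transposes compose:
   the sizes of transpose (transpose X s) t are
     dims (transpose X s) (t k) = dims X (s (t k)),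
   whereas those of transpose X (s * t)%g are dims X (t (s k)). *)

(* Main.v *)
Require Import Defs.
From mathcomp Require Import all_boot all_order all_algebra all_fingroup.
From mathcomp Require Import boolp reals.

(** Sizes are pulled back along [sigma] after [tau], and indices along its inverse: mode [k] of [X]
    reads position [tau^-1 (sigma^-1 k)], which is [(tau * sigma)^-1 k]. By [tensor_eqP] indices are
    compared as naturals, where casts disappear. *)

Theorem proposition2p5 (R : realType) (n : nat) (X : tensor R n)
    (sigma tau : 'S_n) :
  transpose (transpose X sigma) tau = transpose X (tau * sigma)%g.
Proof.
apply: tensor_eqP => [k|i j ij] /=; first by rewrite permM.
congr (entry _); apply: functional_extensionality_dep => k.
apply: val_inj; rewrite /= ij.
(* The type of [j m] depends on [m]; its value in [nat] does not, so it suffices to equate the two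
   modes. *)
by apply: (congr1 (fun m => j m : nat)); rewrite invMg permM.
Qed.
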